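(* Let $\Bbbk$ be an infinite field, let $q \in \Bbbk^*$ be not a root of unity, and let $A = \Bbbk_q[x,y]$ be the Quantum Plane. Then for every finite subgroup $G$ of $\mathrm{Aut}(A)$ there exists a derivation $\delta \in \mathrm{Der}(A)$ such that $\mathrm{Aut}_\delta(A) \cong G$; that is, the class of isotropy groups of $A$ includes, up to isomorphism, all finite subgroups of $\mathrm{Aut}(A)$.
   Context: The Quantum Plane $\Bbbk_q[x,y]$ is the quotient of the free associative $\Bbbk$-algebra $\Bbbk\langle x,y\rangle$ by the two-sided ideal generated by $yx - qxy$. $\mathrm{Der}(A)$ is the set of $\Bbbk$-derivations of $A$ and $\mathrm{Aut}(A)$ the group of $\Bbbk$-algebra automorphisms of $A$. For $q \neq \pm 1$ it is known that every automorphism of $A$ has the form $x \mapsto \mu_1 x$, $y \mapsto \mu_2 y$ with $\mu_1,\mu_2 \in \Bbbk^*$, so $\mathrm{Aut}(A) \cong \Bbbk^* \oplus \Bbbk^*$. For $\delta \in \mathrm{Der}(A)$, the isotropy group is $\mathrm{Aut}_\delta(A) = \{\rho \in \mathrm{Aut}(A) : \rho\delta = \delta\rho\}$. *)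

(* Defs.v *)
From HB Require Import structures.
From mathcomp Require Import all_boot all_order all_algebra.
From mathcomp Require Import generic_quotient ring_quotient.
From mathcomp Require Import boolp classical_sets functions cardinality.
From mathcomp Require Import monalg.

Set Implicit Arguments.
Unset Strict Implicit.
Unset Printing Implicit Defensive.

Import GRing.Theory.

Local Open Scope ring_scope.
Local Open Scope quotient_scope.

Section TwoSidedIdeal.
Variable R : pzRingType.
Implicit Types (I : {pred R}) (S : set R).

Definition two_sided_ideal I : Prop :=
  zmod_closed I /\
  forall a u, u \in I -> (a * u \in I) /\ (u * a \in I).

(* The intersection of all two-sided ideals containing S; the classical [< >]
   makes it a boolean predicate, as required by Quotient.quot. *)
Definition ideal_gen S : {pred R} := fun u =>
  `[< forall I, two_sided_ideal I -> {in S, forall s, s \in I} -> u \in I >].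

Lemma ideal_genP S u :
  reflect (forall I, two_sided_ideal I -> {in S, forall s, s \in I} -> u \in I)
          (u \in ideal_gen S).
Proof. exact: asboolP. Qed.

Lemma ideal_gen_ideal S : two_sided_ideal (ideal_gen S).
Proof.
split; first split.
- by apply/ideal_genP => I [[]].
- move=> u v /ideal_genP hu /ideal_genP hv; apply/ideal_genP => I idI SI.
  by case: (idI) => -[_ subI] _; apply: subI; [exact: hu | exact: hv].
move=> a u /ideal_genP hu; split; apply/ideal_genP => I idI SI.
  exact: ((idI.2 a _ (hu I idI SI)).1).
exact: ((idI.2 a _ (hu I idI SI)).2).
Qed.

Lemma mem_ideal_gen S s : s \in S -> s \in ideal_gen S.
Proof. by move=> Ss; apply/ideal_genP => I _; apply. Qed.

HB.instance Definition _ S :=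
  GRing.isZmodClosed.Build R (ideal_gen S) (ideal_gen_ideal S).1.

Lemma ideal_genMl S a u : u \in ideal_gen S -> a * u \in ideal_gen S.
Proof. by case/((ideal_gen_ideal S).2 a). Qed.

Lemma ideal_genMr S a u : u \in ideal_gen S -> u * a \in ideal_gen S.
Proof. by case/((ideal_gen_ideal S).2 a). Qed.

End TwoSidedIdeal.

Section AlgebraQuotient.
Variables (K : comNzRingType) (A : algType K) (S : set A).

Definition alg_quot : Type := Quotient.quot (ideal_gen S).

HB.instance Definition _ := Choice.on alg_quot.
HB.instance Definition _ := GRing.Zmodule.on alg_quot.

Definition alg_pi (u : A) : alg_quot := \pi_(Quotient.quot (ideal_gen S)) u.
Definition alg_repr (u : alg_quot) : A := repr u.

Lemma alg_reprK : cancel alg_repr alg_pi.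
Proof. exact: reprK. Qed.

Lemma alg_piP u v : reflect (alg_pi u = alg_pi v) (u - v \in ideal_gen S).
Proof. by rewrite (Quotient.idealrBE (ideal_gen S)); apply: eqP. Qed.

Fact alg_pi_is_zmod_morphism : zmod_morphism alg_pi.
Proof. exact: raddfB. Qed.

HB.instance Definition _ :=
  GRing.isZmodMorphism.Build A alg_quot alg_pi alg_pi_is_zmod_morphism.

End AlgebraQuotient.

(* Multiplication and scaling are computed on representatives; alg_pi is shown
   below to be an algebra morphism, with kernel ideal_gen S by alg_piP. The
   operations are locked to keep conversion from unfolding them. *)
HB.lock Definition alg_quot_mul (K : comNzRingType) (A : algType K) (S : set A)
    (u v : alg_quot S) : alg_quot S :=
  alg_pi S (alg_repr u * alg_repr v).

HB.lock Definition alg_quot_scale (K : comNzRingType) (A : algType K)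
    (S : set A) (c : K) (u : alg_quot S) : alg_quot S :=
  alg_pi S (c *: alg_repr u).

Section AlgebraQuotientTheory.
Variables (K : comNzRingType) (A : algType K) (S : set A).

Local Notation alg_quot := (alg_quot S).
Local Notation alg_pi := (alg_pi S).
Local Notation alg_quot_mul := (@alg_quot_mul K A S).
Local Notation alg_quot_scale := (@alg_quot_scale K A S).

Let reprB u : alg_repr (alg_pi u) - u \in ideal_gen S.
Proof. by apply/alg_piP; rewrite alg_reprK. Qed.

Let piM u v : alg_quot_mul (alg_pi u) (alg_pi v) = alg_pi (u * v).
Proof.
rewrite unlock; apply/alg_piP; set u' := alg_repr _; set v' := alg_repr _.
have -> : u' * v' - u * v = u' * (v' - v) + (u' - u) * v.
  by rewrite mulrBr mulrBl addrA subrK.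
by apply: rpredD; [apply: ideal_genMl | apply: ideal_genMr]; apply: reprB.
Qed.

Let piZ c u : alg_quot_scale c (alg_pi u) = alg_pi (c *: u).
Proof.
rewrite unlock; apply/alg_piP.
by rewrite -scalerBr -mulr_algl; apply/ideal_genMl/reprB.
Qed.

Let quotW (P : alg_quot -> Prop) : (forall u, P (alg_pi u)) -> forall u, P u.
Proof. by move=> Ppi u; rewrite -[u]alg_reprK. Qed.

Fact alg_quot_mulA : associative alg_quot_mul.
Proof.
by elim/quotW=> u; elim/quotW=> v; elim/quotW=> w; rewrite !piM mulrA.
Qed.

Fact alg_quot_mul1 : left_id (alg_pi 1) alg_quot_mul.
Proof. by elim/quotW=> u; rewrite piM mul1r. Qed.

Fact alg_quot_mulr1 : right_id (alg_pi 1) alg_quot_mul.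
Proof. by elim/quotW=> u; rewrite piM mulr1. Qed.

Fact alg_quot_mulDl : left_distributive alg_quot_mul +%R.
Proof.
elim/quotW=> u; elim/quotW=> v; elim/quotW=> w.
by rewrite -raddfD !piM mulrDl raddfD.
Qed.

Fact alg_quot_mulDr : right_distributive alg_quot_mul +%R.
Proof.
elim/quotW=> u; elim/quotW=> v; elim/quotW=> w.
by rewrite -raddfD !piM mulrDr raddfD.
Qed.

HB.instance Definition _ := GRing.Zmodule_isPzRing.Build alg_quot
  alg_quot_mulA alg_quot_mul1 alg_quot_mulr1 alg_quot_mulDl alg_quot_mulDr.

Fact alg_quot_scaleA a b u :
  alg_quot_scale a (alg_quot_scale b u) = alg_quot_scale (a * b) u.
Proof. by elim/quotW: u => u; rewrite !piZ scalerA. Qed.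

Fact alg_quot_scale1 : left_id 1 alg_quot_scale.
Proof. by elim/quotW=> u; rewrite piZ scale1r. Qed.

Fact alg_quot_scaleDr : right_distributive alg_quot_scale +%R.
Proof.
move=> c; elim/quotW=> u; elim/quotW=> v.
by rewrite -raddfD !piZ scalerDr raddfD.
Qed.

Fact alg_quot_scaleDl u : {morph alg_quot_scale^~ u : a b / a + b}.
Proof. by elim/quotW: u => u a b; rewrite !piZ scalerDl raddfD. Qed.

HB.instance Definition _ := GRing.Zmodule_isLmodule.Build K alg_quot
  alg_quot_scaleA alg_quot_scale1 alg_quot_scaleDr alg_quot_scaleDl.

Fact alg_pi_is_monoid_morphism : monoid_morphism alg_pi.
Proof. by split=> // u v; exact: (esym (piM u v)). Qed.

HB.instance Definition _ :=
  GRing.isMonoidMorphism.Build A alg_quot alg_pi alg_pi_is_monoid_morphism.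

Fact alg_pi_is_scalable : scalable alg_pi.
Proof. by move=> c u; exact: (esym (piZ c u)). Qed.

HB.instance Definition _ :=
  GRing.isScalable.Build K A alg_quot *:%R alg_pi alg_pi_is_scalable.

Fact alg_quot_scaleAl c (u v : alg_quot) : c *: (u * v) = (c *: u) * v.
Proof.
elim/quotW: u => u; elim/quotW: v => v.
by rewrite -rmorphM -!linearZ -rmorphM /= scalerAl.
Qed.

Fact alg_quot_scaleAr c (u v : alg_quot) : c *: (u * v) = u * (c *: v).
Proof.
elim/quotW: u => u; elim/quotW: v => v.
by rewrite -rmorphM -!linearZ -rmorphM /= scalerAr.
Qed.

End AlgebraQuotientTheory.

(* The free associative algebra on n letters, realized as the monoid algebra
   of the free monoid {fmonom 'I_n}; multiplication and scaling are those of
   the monoid algebra, locked to keep conversion from unfolding them. *)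
Definition free_alg (K : fieldType) (n : nat) : Type := {malg K[{fmonom 'I_n}]}.

HB.lock Definition free_alg_mul (K : fieldType) (n : nat)
    (u v : {malg K[{fmonom 'I_n}]}) : {malg K[{fmonom 'I_n}]} :=
  u * v.

HB.lock Definition free_alg_scale (K : fieldType) (n : nat)
    (c : K) (u : {malg K[{fmonom 'I_n}]}) : {malg K[{fmonom 'I_n}]} :=
  c *: u.

Fact malg_scaleAr (R : comNzRingType) (M : monomType) (c : R)
    (u v : {malg R[M]}) :
  c *: (u * v) = u * (c *: v).
Proof.
rewrite (malgMEw (finmap.fsubset_refl _) (msuppZ_le c v)) malgME scaler_sumr.
apply: eq_bigr => k1 _; rewrite scaler_sumr; apply: eq_bigr => k2 _.
apply/malgP=> k; rewrite (mcoeffZ c v) mulrCA mcoeffZ.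
by rewrite !mcoeffU mulrnAr.
Qed.

Section FreeAlgebra.
Variables (K : fieldType) (n : nat).

Local Notation malgT := {malg K[{fmonom 'I_n}]}.
Local Notation free_alg := (free_alg K n).
Local Notation free_alg_mul := (@free_alg_mul K n).
Local Notation free_alg_scale := (@free_alg_scale K n).

HB.instance Definition _ := GRing.Zmodule.on free_alg.

Fact free_alg_mulA : associative free_alg_mul.
Proof. by rewrite unlock; exact: mulrA. Qed.

Fact free_alg_mul1 : left_id (1 : malgT) free_alg_mul.
Proof. by rewrite unlock; exact: mul1r. Qed.

Fact free_alg_mulr1 : right_id (1 : malgT) free_alg_mul.
Proof. by rewrite unlock; exact: mulr1. Qed.

Fact free_alg_mulDl : left_distributive free_alg_mul +%R.
Proof. by rewrite unlock; exact: mulrDl. Qed.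

Fact free_alg_mulDr : right_distributive free_alg_mul +%R.
Proof. by rewrite unlock; exact: mulrDr. Qed.

Fact free_alg_oner_neq0 : (1 : malgT) != 0.
Proof. exact: oner_neq0. Qed.

HB.instance Definition _ := GRing.Zmodule_isNzRing.Build free_alg
  free_alg_mulA free_alg_mul1 free_alg_mulr1 free_alg_mulDl free_alg_mulDr
  free_alg_oner_neq0.

Fact free_alg_scaleA a b u :
  free_alg_scale a (free_alg_scale b u) = free_alg_scale (a * b) u.
Proof. by rewrite unlock; exact: scalerA. Qed.

Fact free_alg_scale1 : left_id 1 free_alg_scale.
Proof. by rewrite unlock; exact: scale1r. Qed.

Fact free_alg_scaleDr : right_distributive free_alg_scale +%R.
Proof. by rewrite unlock; exact: scalerDr. Qed.

Fact free_alg_scaleDl u : {morph free_alg_scale^~ u : a b / a + b}.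
Proof. by rewrite unlock => a b; exact: scalerDl. Qed.

HB.instance Definition _ := GRing.Zmodule_isLmodule.Build K free_alg
  free_alg_scaleA free_alg_scale1 free_alg_scaleDr free_alg_scaleDl.

Lemma free_algME (u v : free_alg) : u * v = (u : malgT) * (v : malgT).
Proof. by rewrite [LHS]/GRing.mul/= unlock. Qed.

Lemma free_algZE c (u : free_alg) : c *: u = c *: (u : malgT).
Proof. by rewrite [LHS]/GRing.scale/= unlock. Qed.

Fact free_alg_scaleAl c (u v : free_alg) : c *: (u * v) = (c *: u) * v.
Proof. by rewrite !free_algME !free_algZE scalerAl. Qed.

HB.instance Definition _ :=
  GRing.Lmodule_isLalgebra.Build K free_alg free_alg_scaleAl.

Fact free_alg_scaleAr c (u v : free_alg) : c *: (u * v) = u * (c *: v).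
Proof.
by rewrite !free_algME !free_algZE malg_scaleAr.
Qed.

HB.instance Definition _ :=
  GRing.Lalgebra_isAlgebra.Build K free_alg free_alg_scaleAr.

Definition free_gen (i : 'I_n) : free_alg := << fmu i >>.

End FreeAlgebra.

Section QuantumPlane.
Variables (K : fieldType) (q : K).

Let x : free_alg K 2 := free_gen K ord0.
Let y : free_alg K 2 := free_gen K ord_max.

Definition qplane : Type := alg_quot [set y * x - q *: (x * y)].

HB.instance Definition _ := Choice.on qplane.
HB.instance Definition _ := GRing.PzRing.on qplane.
HB.instance Definition _ := GRing.Lmodule.on qplane.

Fact qplane_oner_neq0 : (1 : qplane) != 0.
Proof.
pose aug : free_alg K 2 -> K := @mcoeff {fmonom 'I_2} K mone.
have augM u v : aug (u * v) = aug u * aug v.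
  by rewrite free_algME; exact: rmorphM.
have augB u v : aug (u - v) = aug u - aug v by exact: raddfB.
have augZ c u : aug (c *: u) = c * aug u.
  by rewrite free_algZE; exact: mcoeffZ.
have aug_gen i : aug (free_gen K i) = 0 by rewrite /aug mcoeffU1 fmP fmU fm1.
have aug1 : aug 1 = 1 by exact: rmorph1.
clearbody aug.
have aug_rel u v : aug u = 0 -> aug v = 0 -> aug (v * u - q *: (u * v)) = 0.
  by move=> u0 v0; rewrite augB augZ !augM u0 v0 !mulr0 subr0.
pose I : {pred free_alg K 2} := fun u => aug u == 0.
have idI : two_sided_ideal I.
  split; first split; rewrite ?unfold_in.
  - by apply/eqP; rewrite -(subrr 0) augB subrr.
  - by move=> u v /eqP u0 /eqP v0; rewrite unfold_in augB u0 v0 subr0.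
  by move=> a u /eqP u0; split; apply/eqP; rewrite augM u0 ?mulr0 ?mul0r.
apply/eqP => pi10.
have /ideal_genP/(_ I idI) : 1 - 0 \in ideal_gen [set y * x - q *: (x * y)].
  by apply/alg_piP; rewrite raddf0.
suff relI : {in [set y * x - q *: (x * y)]%classic, forall s, s \in I}.
  by move/(_ relI); rewrite subr0 unfold_in aug1 oner_eq0.
move=> s; rewrite inE => ->.
by apply/eqP/aug_rel; apply: aug_gen.
Qed.

HB.instance Definition _ :=
  GRing.PzSemiRing_isNonZero.Build qplane qplane_oner_neq0.
HB.instance Definition _ := GRing.Lmodule_isLalgebra.Build K qplane
  (@alg_quot_scaleAl _ _ _).
HB.instance Definition _ := GRing.Lalgebra_isAlgebra.Build K qplane
  (@alg_quot_scaleAr _ _ _).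

End QuantumPlane.

Section AutDer.
Variables (K : comNzRingType) (A : algType K).

Definition is_alg_aut : {pred A -> A} := fun f =>
  `[< [/\ linear f, monoid_morphism f & bijective f] >].

Record alg_aut := AlgAut {
  alg_aut_fun :> A -> A;
  _ : alg_aut_fun \in is_alg_aut
}.

HB.instance Definition _ := [isSub for alg_aut_fun].
HB.instance Definition _ := [Choice of alg_aut by <:].

Lemma is_alg_autP (f : A -> A) :
  reflect [/\ linear f, monoid_morphism f & bijective f] (f \in is_alg_aut).
Proof. exact: asboolP. Qed.

Lemma alg_autP (f : alg_aut) : [/\ linear f, monoid_morphism f & bijective f].
Proof. exact/is_alg_autP/(valP f). Qed.

Lemma alg_aut_eqP (f g : alg_aut) : f =1 g <-> f = g.
Proof. by split=> [fg|->//]; apply: val_inj; apply: funext. Qed.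

Fact alg_aut_one_subproof : idfun \in is_alg_aut.
Proof. by apply/is_alg_autP; split=> //; exists idfun. Qed.

Fact alg_aut_mul_subproof (f g : alg_aut) : f \o g \in is_alg_aut.
Proof.
have [fL [f1 fM] fB] := alg_autP f; have [gL [g1 gM] gB] := alg_autP g.
apply/is_alg_autP; split; last exact: bij_comp.
- by move=> c u v /=; rewrite gL fL.
- by split=> [|u v] /=; rewrite ?g1 ?gM.
Qed.

Fact alg_aut_inv_exists (f : alg_aut) :
  exists g : alg_aut, cancel f g /\ cancel g f.
Proof.
have [fL [f1 fM] [g fK gK]] := alg_autP f.
suff gA : g \in is_alg_aut by exists (AlgAut gA).
apply/is_alg_autP; split; last by exists f.
- by move=> c u v; apply: (canLR fK); rewrite fL !gK.
- by split=> [|u v]; apply: (canLR fK); rewrite ?f1 // fM !gK.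
Qed.

Definition alg_aut_one := AlgAut alg_aut_one_subproof.
Definition alg_aut_mul (f g : alg_aut) := AlgAut (alg_aut_mul_subproof f g).
Definition alg_aut_inv (f : alg_aut) := projT1 (cid (alg_aut_inv_exists f)).

Lemma alg_autK (f : alg_aut) : cancel f (alg_aut_inv f).
Proof. exact: (projT2 (cid (alg_aut_inv_exists f))).1. Qed.

Lemma alg_autKV (f : alg_aut) : cancel (alg_aut_inv f) f.
Proof. exact: (projT2 (cid (alg_aut_inv_exists f))).2. Qed.

Fact alg_aut_mulA : associative alg_aut_mul.
Proof. by move=> f g h; apply/alg_aut_eqP. Qed.

Fact alg_aut_mul1 : left_id alg_aut_one alg_aut_mul.
Proof. by move=> f; apply/alg_aut_eqP. Qed.

Fact alg_aut_mulr1 : right_id alg_aut_one alg_aut_mul.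
Proof. by move=> f; apply/alg_aut_eqP. Qed.

Fact alg_aut_mulV : left_inverse alg_aut_one alg_aut_inv alg_aut_mul.
Proof. by move=> f; apply/alg_aut_eqP => u; apply: alg_autK. Qed.

Fact alg_aut_mulrV : right_inverse alg_aut_one alg_aut_inv alg_aut_mul.
Proof. by move=> f; apply/alg_aut_eqP => u; apply: alg_autKV. Qed.

HB.instance Definition _ := isGroup.Build alg_aut
  alg_aut_mulA alg_aut_mul1 alg_aut_mulr1 alg_aut_mulV alg_aut_mulrV.

Record derivation := Derivation {
  der_fun :> A -> A;
  der_linear : linear der_fun;
  der_leibniz : forall u v, der_fun (u * v) = der_fun u * v + u * der_fun v
}.

Definition isotropy (d : derivation) : {pred alg_aut} :=
  fun rho => `[< rho \o d = d \o rho >].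

End AutDer.

(* Isomorphism of the subgroups H and G; f is irrelevant outside H. *)
Definition group_isog (S T : groupType) (H : {pred S}) (G : {pred T}) : Prop :=
  exists f : S -> T, set_bij [set` H] [set` G] f /\
    {in H &, forall x y, f (x * y)%g = (f x * f y)%g}.

(* Main.v *)
Require Import Defs.
From mathcomp Require Import all_boot all_order all_algebra.
From mathcomp Require Import zify.
From mathcomp Require Import monalg.
From mathcomp Require Import boolp classical_sets functions cardinality.

(* The monomials [x ^+ a * y ^+ b] form a basis of the quantum plane, and the
   Newton polygon of a product is the sum of the Newton polygons. An automorphism
   preserves the commutator ideal [(x * y)], hence the line [K * (x * y)]; its
   values at [x] and [y] are then two monomials of product proportional to
   [x * y], so it is diagonal because [q ^+ 2 != 1]. The isotropy group of the
   inner derivation [ad w] is the stabilizer of [w] modulo the center, that is,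
   modulo the constants. Let [w] be the sum of all nonconstant monomials with
   exponents at most [#|G|] that are fixed by [G]: a finite subgroup of a torus
   is the common kernel of the characters that are trivial on it, so the isotropy
   group of [ad w] is [G] itself. *)

Set Implicit Arguments.
Unset Strict Implicit.
Unset Printing Implicit Defensive.

Import GRing.Theory.
Local Open Scope ring_scope.

(** * Multiplication on arrays of monomial coefficients *)

Section TwistedConvolution.
Variables (K : fieldType) (q : K).
Hypothesis q_neq0 : q != 0.
Implicit Types f g : nat -> nat -> K.

(** The coefficient of [x ^+ k * y ^+ l] in a product: [y ^+ j] moves past [x ^+ (k - i)] at the
    cost of [q ^+ (j * (k - i))]. *)
Definition twconv f g (k l : nat) : K :=
  \sum_(i < k.+1) \sum_(j < l.+1)
     q ^+ (j * (k - i)) * (f i j * g (k - i)%N (l - j)%N).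

Definition supp_lt (N : nat) f :=
  forall i j, f i j != 0 -> (i < N)%N /\ (j < N)%N.

Lemma supp_lt_le N N' f : (N <= N')%N -> supp_lt N f -> supp_lt N' f.
Proof. by move=> le_N fN i j /fN[iN jN]; split; apply: leq_trans le_N. Qed.

Lemma twconvDl f f' g k l :
  twconv (fun i j => f i j + f' i j) g k l = twconv f g k l + twconv f' g k l.
Proof.
rewrite /twconv -big_split; apply: eq_bigr => i _; rewrite -big_split.
by apply: eq_bigr => j _; rewrite /= mulrDl mulrDr.
Qed.

Lemma twconvDr f g g' k l :
  twconv f (fun i j => g i j + g' i j) k l = twconv f g k l + twconv f g' k l.
Proof.
rewrite /twconv -big_split; apply: eq_bigr => i _; rewrite -big_split.
by apply: eq_bigr => j _; rewrite /= !mulrDr.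
Qed.

Lemma eq_twconv f f' g g' k l : f =2 f' -> g =2 g' ->
  twconv f g k l = twconv f' g' k l.
Proof.
by move=> ff' gg'; apply: eq_bigr => i _; apply: eq_bigr => j _; rewrite ff' gg'.
Qed.

Lemma twconv_neq0 f g k l : twconv f g k l != 0 ->
  exists i j i' j',
    [/\ f i j != 0, g i' j' != 0, (i + i')%N = k & (j + j')%N = l].
Proof.
move=> fg; apply: contrapT => /forallNP nex; case/eqP: fg.
rewrite /twconv big1 // => i _; apply: big1 => j _.
have [->|fij] := eqVneq (f i j) 0; first by rewrite mul0r mulr0.
have [->|gij] := eqVneq (g (k - i)%N (l - j)%N) 0; first by rewrite !mulr0.
case: (nex i); exists (j : nat), (k - i)%N, (l - j)%N.
by rewrite !subnKC // -ltnS ltn_ord.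
Qed.

(** With [l = 0] no [y] crosses an [x], so the twist is trivial and the convolution is
    commutative. *)
Lemma twconv_row0 f g k : twconv f g k 0 = twconv g f k 0.
Proof.
rewrite /twconv (reindex_inj rev_ord_inj); apply: eq_bigr => i _.
rewrite !big_ord1 /= !mul0n subSS subKn; last by rewrite -ltnS.
by congr (_ * _); exact: mulrC.
Qed.

Lemma twconv_col0 f g l : twconv f g 0 l = twconv g f 0 l.
Proof.
rewrite /twconv !big_ord1 (reindex_inj rev_ord_inj); apply: eq_bigr => j _.
rewrite !muln0 /= subSS subKn; last by rewrite -ltnS.
by congr (_ * _); exact: mulrC.
Qed.

(** The hypothesis leaves one decomposition of the sum point over the two supports, as at a vertex
    of a Newton polygon, so nothing can cancel. *)
Lemma twconv_extreme f g a b c d :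
  (forall i j i' j', f i j != 0 -> g i' j' != 0 ->
     (i + i' = a + c)%N -> (j + j' = b + d)%N -> i = a /\ j = b) ->
  twconv f g (a + c) (b + d) = q ^+ (b * c) * (f a b * g c d).
Proof.
move=> ext.
have term0 (i : 'I_(a + c).+1) (j : 'I_(b + d).+1) : ~ (i = a :> nat /\ j = b :> nat) ->
    q ^+ (j * (a + c - i)) * (f i j * g (a + c - i)%N (b + d - j)%N) = 0.
  move=> nij; case: (eqVneq (f i j) 0) => [->|fij]; first by rewrite mul0r mulr0.
  set t := g _ _; case: (eqVneq t 0) => [->|gij]; first by rewrite !mulr0.
  by case: nij; apply: (ext _ _ _ _ fij gij); rewrite subnKC // -ltnS.
have la : (a < (a + c).+1)%N by rewrite ltnS leq_addr.
have lb : (b < (b + d).+1)%N by rewrite ltnS leq_addr.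
rewrite /twconv (bigD1 (Ordinal la)) //= [X in _ + X]big1 ?addr0; last first.
  move=> i nia; apply: big1 => j _; apply: term0 => -[ia _].
  by case/eqP: nia; apply: val_inj.
rewrite (bigD1 (Ordinal lb)) //= big1 ?addr0 ?addKn // => j njb.
have := term0 (Ordinal la) j; rewrite /= addKn => t0.
by apply: t0 => -[_ jb]; case/eqP: njb; apply: val_inj.
Qed.

(* The Newton polygon of a product is the Minkowski sum of those of its
   factors; it suffices to look at its two extreme points for the total order
   given by the key [i * N + j]. *)
Lemma twconv_single f g N s t :
    supp_lt N f -> supp_lt N g ->
    (exists i j, f i j != 0) -> (exists i j, g i j != 0) ->
    (forall k l, twconv f g k l != 0 -> k = s /\ l = t) ->
  exists a b c d, [/\ (a + c = s)%N, (b + d = t)%N,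
    forall i j, f i j != 0 -> i = a /\ j = b &
    forall i j, g i j != 0 -> i = c /\ j = d].
Proof.
move=> fN gN f0 g0 fg.
(* Additive in the point, and injective for [j < N] as a base-[N] encoding. *)
pose key i j := (i * N + j)%N.
have key_inj i j i' j' : (j < N)%N -> (j' < N)%N -> key i j = key i' j' ->
    i = i' /\ j = j'.
  rewrite /key => jN j'N e; have i_eq : i = i' by nia.
  by split=> //; move: e; rewrite i_eq; lia.
have ext h : supp_lt N h -> (exists i j, h i j != 0) ->
    exists a b a' b', [/\ h a b != 0, h a' b' != 0 & forall i j, h i j != 0 ->
      (key a b <= key i j)%N /\ (key i j <= key a' b')%N].
  move=> hN [i0 [j0 h0]].
  pose P m := `[< exists i j, h i j != 0 /\ key i j = m >].
  have exP : exists m, P m by exists (key i0 j0); apply/asboolP; exists i0, j0.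
  have ubP m : P m -> (m <= N * N + N)%N.
    by move=> /asboolP[i [j [/hN[iN jN] <-]]]; rewrite /key; nia.
  case: (ex_minnP exP) => m /asboolP[a [b [hab <-]]] minP.
  case: (ex_maxnP exP ubP) => m' /asboolP[a' [b' [hab' <-]]] maxP.
  exists a, b, a', b'; split=> // i j hij.
  by split; [apply: minP | apply: maxP]; apply/asboolP; exists i, j.
have [a [b [a' [b' [fab fab' fext]]]]] := ext f fN f0.
have [c [d [c' [d' [gcd gcd' gext]]]]] := ext g gN g0.
(* The two minimal points have a sum with a unique decomposition, so the coefficient there is
   nonzero; likewise for the maximal points below. *)
have [acs bdt] : (a + c)%N = s /\ (b + d)%N = t.
  apply: fg; rewrite twconv_extreme ?mulf_neq0 ?expf_neq0 // => i j i' j' fij gij e1 e2.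
  have [le1 _] := fext _ _ fij; have [le2 _] := gext _ _ gij.
  have [[_ jN] [_ bN]] := (fN _ _ fij, fN _ _ fab).
  by apply: key_inj => //; move: le1 le2; rewrite /key; nia.
have [acs' bdt'] : (a' + c')%N = s /\ (b' + d')%N = t.
  apply: fg; rewrite twconv_extreme ?mulf_neq0 ?expf_neq0 // => i j i' j' fij gij e1 e2.
  have [_ le1] := fext _ _ fij; have [_ le2] := gext _ _ gij.
  have [[_ jN] [_ bN]] := (fN _ _ fij, fN _ _ fab').
  by apply: key_inj => //; move: le1 le2; rewrite /key; nia.
have [lef _] := fext _ _ fab'; have [leg _] := gext _ _ gcd'.
(* Both sides are the key of [(s, t)]; hence on each factor the minimal and maximal keys agree. *)
have eqkey : (key a b + key c d = key a' b' + key c' d')%N.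
  by rewrite /key; nia.
exists a, b, c, d; split=> // i j hij.
  have [le1 le2] := fext _ _ hij; have [[_ jN] [_ bN]] := (fN _ _ hij, fN _ _ fab).
  by apply: key_inj => //; lia.
have [le1 le2] := gext _ _ hij; have [[_ jN] [_ dN]] := (gN _ _ hij, gN _ _ gcd).
by apply: key_inj => //; lia.
Qed.

End TwistedConvolution.

(** * Characters of finite subgroups of the two-dimensional torus *)

Section TorusCharacters.
Variable K : fieldType.
Implicit Types (g h z : K * K) (s : seq (K * K)).

(** The factor by which the diagonal automorphism with parameters [z] scales [x ^+ a * y ^+ b]. *)
Definition torus_char (a b : nat) (z : K * K) : K := z.1 ^+ a * z.2 ^+ b.

Lemma torus_charM a b g h :
  torus_char a b (g * h) = torus_char a b g * torus_char a b h.
Proof. by rewrite /torus_char /= !exprMn mulrACA. Qed.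

Variable s : seq (K * K).
Hypotheses (s_uniq : uniq s) (s1 : 1 \in s).
Hypothesis sM : {in s &, forall g h, g * h \in s}.
Hypothesis s_neq0 : {in s, forall g, g.1 != 0 /\ g.2 != 0}.

Lemma torus_mulI g : g.1 != 0 -> g.2 != 0 -> injective ( *%R g).
Proof.
move=> g1 g2 [h1 h2] [h1' h2'] [/(mulfI g1) -> /(mulfI g2) ->] //.
Qed.

Lemma perm_torus_mul g : g \in s -> perm_eq (map ( *%R g) s) s.
Proof.
move=> gs; have [g1 g2] := s_neq0 gs; have gI := torus_mulI g1 g2.
have sub : {subset map ( *%R g) s <= s} by move=> _ /mapP[h hs ->]; apply: sM.
have u : uniq (map ( *%R g) s) by rewrite map_inj_uniq.
apply: uniq_perm => //.
by case: (uniq_min_size u sub); rewrite ?size_map.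
Qed.

(** Translation by [g] permutes [s], so it fixes the product of all character values, yet multiplies
    it by this power. *)
Lemma torus_char_expn a b g : g \in s -> torus_char a b g ^+ size s = 1.
Proof.
move=> gs; have P0 : \prod_(h <- s) torus_char a b h != 0.
  rewrite prodf_seq_neq0; apply/allP => h /s_neq0[h1 h2] /=.
  by rewrite /torus_char mulf_neq0 ?expf_neq0.
apply: (mulIf P0); rewrite mul1r -[RHS](perm_big _ (perm_torus_mul gs)) big_map /=.
under [RHS]eq_bigr => h _ do rewrite torus_charM.
by rewrite [RHS]big_split /= big_const_seq count_predT iter_mulr_1.
Qed.

(** Orthogonality: translation by [g0] permutes the terms but multiplies the sum by a factor other
    than 1. *)
Lemma sum_torus_char a b g0 : g0 \in s -> torus_char a b g0 != 1 ->
  \sum_(g <- s) torus_char a b g = 0.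
Proof.
move=> g0s ne1; apply/eqP; move: ne1; apply: contraNT => S0.
rewrite -subr_eq0 -(mulIr_eq0 _ (mulIf S0)) mulrBl mul1r subr_eq0 eq_sym.
rewrite -{1}(perm_big _ (perm_torus_mul g0s)) big_map mulr_sumr.
by apply/eqP/eq_bigr => h _; rewrite torus_charM.
Qed.

(* If [h] were outside, averaging over the group a polynomial that vanishes on
   [s] and on [h * s] except at [h] would produce a combination of invariant
   monomials separating [h] from [1]. *)
Lemma torus_biorth h : h.1 != 0 -> h.2 != 0 ->
  (forall a b, {in s, forall g, torus_char a b g = 1} -> torus_char a b h = 1) ->
  h \in s.
Proof.
move=> h1 h2 hP; apply: contraPT isT => hs.
(* Equal sums over the coset [h * s] and over [s]. Every monomial has this property, by [hP] if it
   is invariant and by orthogonality otherwise. *)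
pose avg (f : K * K -> K) := \sum_(g <- s) f (h * g) = \sum_(g <- s) f g.
(* [f] is a product of linear factors, one per point of [l]; the claim for all monomial multiples of
   [f] is what lets the induction absorb a new factor. *)
have avgP (l : seq (K * K)) : h \notin l -> exists f, [/\ f h != 0,
    {in l, forall z, f z = 0} & forall a b, avg (fun z => torus_char a b z * f z)].
  elim: l => [_|p l IHl].
    exists (fun=> 1); split; rewrite ?oner_eq0 // => a b; rewrite /avg.
    under eq_bigr => g _ do rewrite mulr1 torus_charM.
    under [RHS]eq_bigr => g _ do rewrite mulr1.
    rewrite -mulr_sumr; have [all1|] := pselect {in s, forall g, torus_char a b g = 1}.
      by rewrite hP ?mul1r.
    move=> /existsNP[g /not_implyP[gs /eqP ng1]].
    by rewrite (sum_torus_char gs) // mulr0.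
  rewrite inE negb_or => /andP[hp /IHl[f [fh fl favg]]].
  (* The new factor is [pr - c] for a coordinate [pr] that separates [h] from [p]; a coordinate
     times a monomial is again a monomial. *)
  have lin (pr : K * K -> K) (c : K) (a' b' : nat) :
      pr h != c -> (forall z, z = p -> pr z = c) ->
      (forall a b z, torus_char (a' + a)%N (b' + b)%N z = torus_char a b z * pr z) ->
      exists f, [/\ f h != 0, {in p :: l, forall z, f z = 0} &
        forall a b, avg (fun z => torus_char a b z * f z)].
    move=> prh prp prM; exists (fun z => (pr z - c) * f z); split.
    - by rewrite mulf_neq0 // subr_eq0.
    - move=> z; rewrite inE => /predU1P[/prp->|/fl->]; last by rewrite mulr0.
      by rewrite subrr mul0r.
    move=> a b; have E z : torus_char a b z * ((pr z - c) * f z) =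
        torus_char (a' + a)%N (b' + b)%N z * f z - c * (torus_char a b z * f z).
      by rewrite prM mulrA mulrBr mulrBl; congr (_ - _); rewrite -mulrA mulrCA.
    rewrite /avg; under eq_bigr => g _ do rewrite E.
    under [RHS]eq_bigr => g _ do rewrite E.
    by rewrite !sumrB -!mulr_sumr !favg.
  have [e1|n1] := eqVneq h.1 p.1.
    have n2 : h.2 != p.2.
      by apply: contraNneq hp => e2;
        rewrite (surjective_pairing h) e1 e2 -surjective_pairing.
    apply: (lin snd p.2 0%N 1%N) => // [z -> //|a b z].
    by rewrite /torus_char add0n add1n exprSr mulrA.
  apply: (lin fst p.1 1%N 0%N) => // [z -> //|a b z].
  by rewrite /torus_char add0n add1n exprSr mulrAC.
(* With [f] killing these points, the sum over the coset is [f h], while the sum over [s] is 0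
   because [h] lies outside [s]. *)
have [|f [fh fl /(_ 0%N 0%N)]] := avgP [seq z <- s ++ map ( *%R h) s | z != h].
  by rewrite mem_filter eqxx.
rewrite /avg (bigD1_seq 1) //= big_seq_cond big1 ?addr0; last first.
  move=> g /andP[gs g1]; rewrite [f _]fl ?mulr0 //
    mem_filter mem_cat map_f ?orbT ?andbT //.
  by apply: contraNneq g1 => e; rewrite -(inj_eq (torus_mulI h1 h2)) e mulr1.
rewrite [RHS]big_seq [RHS]big1 => [|g gs]; last first.
  rewrite fl ?mulr0 // mem_filter mem_cat gs andbT.
  by apply: contraNneq hs => <-.
by rewrite /torus_char mulr1 !expr0 !mul1r => /eqP; rewrite (negPf fh).
Qed.

Lemma torus_biorth_bounded h : h.1 != 0 -> h.2 != 0 ->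
  (forall a b, (a <= size s)%N -> (b <= size s)%N -> (a, b) != (0%N, 0%N) ->
     {in s, forall g, torus_char a b g = 1} -> torus_char a b h = 1) ->
  h \in s.
Proof.
move=> h1 h2 hP; set n := size s in hP.
have n_gt0 : (0 < n)%N by rewrite /n; case: (s) s1.
have sn : {in s, forall g, g.1 ^+ n = 1 /\ g.2 ^+ n = 1}.
  move=> g gs; have := (torus_char_expn 1 0 gs, torus_char_expn 0 1 gs).
  by rewrite /torus_char !expr0 !expr1 mulr1 mul1r => -[].
(* The exponents [(n, 0)] and [(0, n)] give characters trivial on [s]; this is why the bound
   includes [n]. Exponents can then be reduced modulo [n]. *)
have hn : h.1 ^+ n = 1 /\ h.2 ^+ n = 1.
  have := (hP n 0%N, hP 0%N n); rewrite /torus_char !expr0 mulr1 mul1r.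
  case=> H1 H2; split; [apply: H1 | apply: H2] => //.
  - by rewrite xpair_eqE andbT -lt0n.
  - by move=> g /sn[-> _]; rewrite expr0 mulr1.
  - by rewrite xpair_eqE -lt0n.
  - by move=> g /sn[_ ->]; rewrite expr0 mulr1.
have red g a b : g.1 ^+ n = 1 /\ g.2 ^+ n = 1 ->
    torus_char (a %% n) (b %% n) g = torus_char a b g.
  by case=> g1 g2; rewrite /torus_char -(expr_mod a g1) -(expr_mod b g2).
apply: torus_biorth => // a b ab1; rewrite -red //.
have [[-> ->]|ab0] := eqVneq (a %% n, b %% n)%N (0%N, 0%N).
  by rewrite /torus_char !expr0 mulr1.
apply: hP => //; try by apply/ltnW/ltn_pmod.
by move=> g gs; rewrite red ?ab1 //; apply: sn.
Qed.

End TorusCharacters.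

(** * Normal-form coefficients on the free algebra *)

Section FreeAlgebraCoefficients.
Variables (K : fieldType) (q : K).
Local Notation malgT := {malg K[{fmonom 'I_2}]}.
Implicit Types (w : seq 'I_2) (u v : malgT).

Definition word_x w := count_mem ord0 w.
Definition word_y w := count_mem ord_max w.

(** The number of inversions, pairs with a [y] before an [x]; sorting the word costs one [q] for
    each. *)
Fixpoint word_inv w : nat :=
  if w is i :: w' then ((i == ord_max) * word_x w' + word_inv w')%N else 0%N.

Lemma word_inv_cat w w' :
  word_inv (w ++ w') = (word_inv w + word_inv w' + word_y w * word_x w')%N.
Proof.
elim: w => [|i w IHw] //=; first by rewrite addn0.
by rewrite IHw /word_x /word_y count_cat /=; lia.
Qed.

(* A word rewrites to [q ^+ word_inv] times [x ^+ word_x * y ^+ word_y]. *)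
Definition word_coef (k l : nat) w : K :=
  q ^+ word_inv w * ((word_x w == k) && (word_y w == l))%:R.

Definition free_coef k l (u : malgT) : K :=
  mmap idfun (fun m : {fmonom 'I_2} => word_coef k l m) u.

Lemma free_coefD k l : {morph free_coef k l : u v / u + v}.
Proof. exact: mmapD. Qed.

Lemma free_coefB k l : {morph free_coef k l : u v / u - v}.
Proof. exact: mmapB. Qed.

Lemma free_coefZ k l c u : free_coef k l (c *: u) = c * free_coef k l u.
Proof.
rewrite /free_coef (mmapEw (msuppZ_le c u)) mmapE mulr_sumr.
by apply: eq_bigr => m _; rewrite (mcoeffZ c u) [RHS]mulrA.
Qed.

Lemma free_coefU k l c m : free_coef k l << c *g m >> = c * word_coef k l m.
Proof. exact: mmapU. Qed.

Lemma malg_ind (P : malgT -> Prop) :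
  P 0 -> (forall u v, P u -> P v -> P (u + v)) -> (forall c m, P << c *g m >>) ->
  forall u, P u.
Proof. by move=> P0 PD PU u; rewrite [u]monalgE; apply: big_ind. Qed.

(** By bilinearity two words suffice, and there the cross term of [word_inv_cat] is the twist of the
    convolution. *)
Lemma free_coefM k l u v : free_coef k l (u * v) =
  twconv q (fun i j => free_coef i j u) (fun i j => free_coef i j v) k l.
Proof.
have z0 i j : free_coef i j 0 = 0 by exact: mmap0.
elim/malg_ind: u => [|u u' IHu IHu'|c m].
- rewrite mul0r z0 /twconv big1 // => i _; apply: big1 => j _.
  by rewrite z0 mul0r mulr0.
- rewrite mulrDl free_coefD IHu IHu' -twconvDl.
  by apply: eq_twconv => // i j; rewrite free_coefD.
elim/malg_ind: v => [|v v' IHv IHv'|c' m'].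
- rewrite mulr0 z0 /twconv big1 // => i _; apply: big1 => j _.
  by rewrite z0 !mulr0.
- rewrite mulrDr free_coefD IHv IHv' -twconvDr.
  by apply: eq_twconv => // i j; rewrite free_coefD.
have -> : << c *g m >> * << c' *g m' >> = << c * c' *g (mmul m m') >> :> malgT.
  by rewrite malgM_def fgmulUU.
rewrite free_coefU /word_coef fmM word_inv_cat /word_x /word_y !count_cat.
rewrite -/(word_x m) -/(word_y m) -/(word_x m') -/(word_y m').
have supp i j c1 (m1 : {fmonom 'I_2}) : free_coef i j << c1 *g m1 >> != 0 ->
    i = word_x m1 /\ j = word_y m1.
  rewrite free_coefU /word_coef; case: (word_x m1 =P i) => [->|_];
    last by rewrite !mulr0 eqxx.
  by case: (word_y m1 =P j) => [->|_] //; rewrite !mulr0 eqxx.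
case: (boolP (_ && _)) => [/andP[/eqP<- /eqP<-]|ne].
  rewrite twconv_extreme; last first.
    by move=> i j i' j' /supp[-> ->].
  rewrite !free_coefU /word_coef !eqxx !mulr1 !exprD.
  by rewrite -!mulrA [RHS]mulrC -!mulrA; congr (_ * _); rewrite mulrCA.
rewrite !mulr0; apply/esym/eqP; move: ne; apply: contraNT.
move=> /twconv_neq0[i [j [i' [j' [/supp[-> ->] /supp[-> ->] <- <-]]]]].
by rewrite !eqxx.
Qed.

End FreeAlgebraCoefficients.

(** * The monomial basis of the quantum plane *)

Section QuantumPlaneBasis.
Variables (K : fieldType) (q : K).
Local Notation A := (qplane q).
Implicit Types u v w : A.

Local Notation X := (free_gen K ord0 : free_alg K 2).
Local Notation Y := (free_gen K ord_max : free_alg K 2).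

Definition qpi (f : free_alg K 2) : A :=
  alg_pi [set Y * X - q *: (X * Y)]%classic f.

Definition qx : A := qpi X.
Definition qy : A := qpi Y.
Definition qmono (a b : nat) : A := qx ^+ a * qy ^+ b.
(** Computed on a chosen representative; [qcoef_pi] shows that the choice does not matter. *)
Definition qcoef (k l : nat) (u : A) : K := free_coef q k l (alg_repr u).

Lemma qpiD f g : qpi (f + g) = qpi f + qpi g. Proof. exact: raddfD. Qed.
Lemma qpiB f g : qpi (f - g) = qpi f - qpi g. Proof. exact: raddfB. Qed.
Lemma qpiM f g : qpi (f * g) = qpi f * qpi g. Proof. exact: rmorphM. Qed.
Lemma qpiZ c f : qpi (c *: f) = c *: qpi f. Proof. exact: linearZ. Qed.
Lemma qpi1 : qpi 1 = 1. Proof. exact: rmorph1. Qed.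
Lemma qpi_repr u : qpi (alg_repr u) = u. Proof. exact: alg_reprK. Qed.

Lemma qyx : qy * qx = q *: (qx * qy).
Proof.
apply/subr0_eq; rewrite -!qpiM -qpiZ -qpiB.
rewrite -[RHS](raddf0 (alg_pi [set Y * X - q *: (X * Y)]%classic)).
by apply/alg_piP; rewrite subr0; apply: mem_ideal_gen; rewrite inE.
Qed.

Lemma free_coef_gen k l (i : 'I_2) :
  free_coef q k l (free_gen K i) = word_coef q k l [:: i].
Proof.
by rewrite /free_gen free_coefU mul1r /fmu fmE.
Qed.

Lemma free_coef_algM k l (f g : free_alg K 2) : free_coef q k l (f * g) =
  twconv q (fun i j => free_coef q i j f) (fun i j => free_coef q i j g) k l.
Proof. by rewrite free_algME free_coefM. Qed.

Lemma qcoef_pi k l f : qcoef k l (qpi f) = free_coef q k l f.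
Proof.
apply/subr0_eq; rewrite /qcoef -free_coefB.
(* The common kernel of the coefficient functionals: an ideal by the convolution formula, and it
   contains the defining relation. *)
pose I : {pred free_alg K 2} := fun h => `[< forall k l, free_coef q k l h = 0 >].
have idI : two_sided_ideal I.
  split; first split.
  - by apply/asboolP => i j; exact: mmap0.
  - move=> h h' /asboolP h0 /asboolP h0'; apply/asboolP => i j.
    by rewrite free_coefB h0 h0' subr0.
  move=> a h /asboolP h0; split; apply/asboolP => i j; rewrite free_coef_algM;
    apply: big1 => i' _; apply: big1 => j' _; by rewrite h0 ?mul0r ?mulr0 ?mulr0.
have relI : {in [set Y * X - q *: (X * Y)]%classic, forall s, s \in I}.
  move=> s; rewrite inE => ->; apply/asboolP => i j.
  rewrite free_coefB.
  have -> : free_coef q i j (q *: (X * Y)) = q * free_coef q i j (X * Y).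
    by rewrite free_algZE free_coefZ.
  have E (a b : 'I_2) : free_coef q i j (free_gen K a * free_gen K b) =
      word_coef q i j [:: a; b].
    rewrite free_algME malgM_def fgmulUU mul1r free_coefU mul1r.
    by rewrite fmM /fmu !fmE.
  by rewrite !E /word_coef /word_x /word_y /= [X in q * X]mul1r subrr.
have := ideal_genP _ _ (introT (alg_piP _ _ _) (qpi_repr (qpi f))) I idI relI.
by move/asboolP; apply.
Qed.

Lemma qcoefD k l : {morph qcoef k l : u v / u + v}.
Proof.
move=> u v; rewrite -[u]qpi_repr -[v]qpi_repr -qpiD !qcoef_pi; exact: free_coefD.
Qed.

Lemma qcoefZ k l c u : qcoef k l (c *: u) = c * qcoef k l u.
Proof. by rewrite -[u]qpi_repr -qpiZ !qcoef_pi free_algZE free_coefZ. Qed.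

Lemma qcoef0 k l : qcoef k l 0 = 0.
Proof. by rewrite -(scale0r 0) qcoefZ mul0r. Qed.

Lemma qcoefB k l : {morph qcoef k l : u v / u - v}.
Proof. by move=> u v; rewrite qcoefD -scaleN1r qcoefZ mulN1r. Qed.

Lemma qcoef_sum k l (I : Type) (r : seq I) (P : pred I) (F : I -> A) :
  qcoef k l (\sum_(i <- r | P i) F i) = \sum_(i <- r | P i) qcoef k l (F i).
Proof. exact: (big_morph _ (qcoefD k l) (qcoef0 k l)). Qed.

Lemma qcoefM k l u v :
  qcoef k l (u * v) = twconv q (fun i j => qcoef i j u) (fun i j => qcoef i j v) k l.
Proof.
rewrite -[u]qpi_repr -[v]qpi_repr -qpiM qcoef_pi free_coef_algM.
by apply: eq_twconv => i j; rewrite qcoef_pi.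
Qed.

Lemma qcoefM_delta u v a b c d : (b * c = 0)%N ->
    (forall k l, qcoef k l u = ((k == a) && (l == b))%:R) ->
    (forall k l, qcoef k l v = ((k == c) && (l == d))%:R) ->
  forall k l, qcoef k l (u * v) = ((k == a + c) && (l == b + d))%N%:R.
Proof.
move=> bc0 hu hv k l; rewrite qcoefM.
rewrite (eq_twconv q k l hu hv).
have supp i j s t : ((i == s) && (j == t))%:R != 0 :> K -> (i = s /\ j = t)%N.
  by case: andP => [[/eqP-> /eqP->] //|]; rewrite eqxx.
have [/andP[/eqP-> /eqP->]|] := boolP (_ && _).
  rewrite twconv_extreme ?eqxx /= ?bc0 ?expr0 ?mulr1 // => i j i' j'.
  by move=> /supp[-> ->].
apply: contraNeq => /twconv_neq0[i [j [i' [j' [/supp[-> ->] /supp[-> ->] <- <-]]]]].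
by rewrite !eqxx.
Qed.

Lemma qcoef_mono a b k l : qcoef k l (qmono a b) = ((k == a) && (l == b))%:R.
Proof.
have h1 i j : qcoef i j 1 = ((i == 0) && (j == 0))%N%:R.
  rewrite -qpi1 qcoef_pi
    -[1]/(<< (mone : {fmonom 'I_2}) >> : {malg K[{fmonom 'I_2}]}) free_coefU mul1r.
  by rewrite /word_coef fm1 /= mul1r ![_ == 0%N]eq_sym.
have hx i j : qcoef i j qx = ((i == 1) && (j == 0))%N%:R.
  by rewrite qcoef_pi free_coef_gen /word_coef /= mul1r
    ![_ == 0%N]eq_sym ![_ == 1%N]eq_sym.
have hy i j : qcoef i j qy = ((i == 0) && (j == 1))%N%:R.
  by rewrite qcoef_pi free_coef_gen /word_coef /= mul1r
    ![_ == 0%N]eq_sym ![_ == 1%N]eq_sym.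
have hxa i j : qcoef i j (qx ^+ a) = ((i == a) && (j == 0))%N%:R.
  elim: a i j => [|a IHa] i j; first by rewrite expr0.
  by rewrite exprS (qcoefM_delta _ hx IHa) // add1n.
have hyb i j : qcoef i j (qy ^+ b) = ((i == 0) && (j == b))%N%:R.
  elim: b i j => [|b IHb] i j; first by rewrite expr0.
  by rewrite exprS (qcoefM_delta _ hy IHb) // ?muln0 // add1n.
by rewrite (qcoefM_delta _ hxa hyb) // addn0.
Qed.

Lemma qmono00 : qmono 0 0 = 1. Proof. by rewrite /qmono !expr0 mulr1. Qed.
Lemma qmono10 : qmono 1 0 = qx. Proof. by rewrite /qmono expr0 mulr1. Qed.
Lemma qmono01 : qmono 0 1 = qy. Proof. by rewrite /qmono expr0 mul1r. Qed.
Lemma qmono11 : qmono 1 1 = qx * qy. Proof. by []. Qed.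

Lemma qyx_exp a b : qy ^+ b * qx ^+ a = q ^+ (a * b) *: (qx ^+ a * qy ^+ b).
Proof.
have base c : qy * qx ^+ c = q ^+ c *: (qx ^+ c * qy).
  elim: c => [|c IHc]; first by rewrite !expr0 mulr1 mul1r scale1r.
  rewrite [qx ^+ _ in LHS]exprSr mulrA IHc -scalerAl -mulrA qyx -scalerAr scalerA.
  by rewrite mulrA -!exprSr.
elim: b => [|b IHb]; first by rewrite muln0 !expr0 mulr1 mul1r scale1r.
rewrite [qy ^+ _ in LHS]exprSr -mulrA base -scalerAr mulrA IHb -scalerAl scalerA.
by rewrite -exprD mulnS -mulrA -exprSr.
Qed.

(** The monomials span, since prepending a letter to a monomial gives a scalar multiple of a
    monomial. *)
Lemma qplane_ind (P : A -> Prop) :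
    P 0 -> (forall u v, P u -> P v -> P (u + v)) ->
    (forall c u, P u -> P (c *: u)) -> (forall a b, P (qmono a b)) ->
  forall u, P u.
Proof.
move=> P0 PD PZ Pm u; rewrite -[u]qpi_repr.
elim/malg_ind: (alg_repr u : {malg K[{fmonom 'I_2}]}) => [|f g Pf Pg|c [w]].
- by rewrite -(subrr 0) [qpi _]qpiB subrr.
- by rewrite [qpi _]qpiD; apply: PD.
have -> : << c *g FMonom w >> = (c *: (<< FMonom w >> : free_alg K 2)).
  rewrite free_algZE; apply/malgP => m.
  by rewrite (mcoeffZ c) !mcoeffU mulr_natr.
rewrite qpiZ; apply: (PZ); have [c' [a [b ->]]] : exists c' a b,
    qpi << FMonom w >> = c' *: qmono a b; last by apply: PZ.
elim: w => [|i w [c' [a [b IHw]]]].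
  exists 1, 0%N, 0%N; rewrite qmono00 scale1r -qpi1; congr qpi.
  by rewrite -[RHS]/(<< (mone : {fmonom 'I_2}) >> : {malg K[{fmonom 'I_2}]})
    /mone /= fmoneE.
have -> : << FMonom (i :: w) >> = free_gen K i * << FMonom w >> :> free_alg K 2.
  rewrite free_algME malgM_def fgmulUU mulr1; congr << _ *g _ >>.
  by apply/eqP; rewrite fmP fmM /fmu fmE.
rewrite qpiM IHw -scalerAr; have [->|] := eqVneq i ord0.
  by exists c', a.+1, b; rewrite -[qpi _]/qx mulrA -exprS.
rewrite -val_eqE /= => i0; have -> : i = ord_max by apply: val_inj; case: i i0 => -[|[|]].
exists (c' * q ^+ a), a, b.+1; rewrite -[qpi _]/qy mulrA -[qy]expr1 qyx_exp muln1.
by rewrite expr1 -scalerAl scalerA -mulrA -exprS.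
Qed.

Definition qtrunc N u : A :=
  \sum_(i < N) \sum_(j < N) qcoef i j u *: qmono i j.

(** Holding for all large bounds lets several elements share one bound. *)
Lemma qtruncE u : exists N, forall N', (N <= N')%N -> qtrunc N' u = u.
Proof.
have truncD N : {morph qtrunc N : u v / u + v}.
  move=> v w; rewrite /qtrunc -big_split; apply: eq_bigr => i _ /=.
  by rewrite -big_split; apply: eq_bigr => j _; rewrite qcoefD scalerDl.
have truncZ N c v : qtrunc N (c *: v) = c *: qtrunc N v.
  rewrite /qtrunc scaler_sumr; apply: eq_bigr => i _ /=.
  by rewrite scaler_sumr; apply: eq_bigr => j _; rewrite qcoefZ scalerA.
elim/qplane_ind: u => [|u v [N IHu] [M IHv]|c u [N IHu]|a b].
- by exists 0%N => N _; rewrite -(scale0r 0) truncZ !scale0r.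
- exists (maxn N M) => P; rewrite geq_max => /andP[NP MP].
  by rewrite truncD IHu ?IHv.
- by exists N => P NP; rewrite truncZ IHu.
exists (a + b).+1 => P ltP.
have aP : (a < P)%N by lia.
have bP : (b < P)%N by lia.
rewrite /qtrunc (bigD1 (Ordinal aP)) //= [X in _ + X]big1 ?addr0 => [|i ia].
  rewrite (bigD1 (Ordinal bP)) //= big1 => [|j jb].
    by rewrite qcoef_mono !eqxx scale1r addr0.
  by rewrite qcoef_mono (negPf (_ : (j != b :> nat))) ?andbF ?scale0r //; exact: jb.
apply: big1 => j _.
by rewrite qcoef_mono (negPf (_ : (i != a :> nat))) ?scale0r //; exact: ia.
Qed.

Lemma qcoef_inj u v : (forall k l, qcoef k l u = qcoef k l v) -> u = v.
Proof.
move=> uv; have [[N uN] [M vM]] := (qtruncE u, qtruncE v).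
rewrite -(uN (maxn N M)) ?leq_maxl // -[RHS](vM (maxn N M)) ?leq_maxr //.
by apply: eq_bigr => i _; apply: eq_bigr => j _; rewrite uv.
Qed.

Lemma qcoef_supp u : exists N, supp_lt N (fun i j => qcoef i j u).
Proof.
have [N /(_ N (leqnn N)) uN] := qtruncE u; exists N => i j.
move=> nz; apply: contrapT => ij; case/eqP: nz.
rewrite -uN qcoef_sum big1 // => i' _; rewrite qcoef_sum big1 // => j' _.
rewrite qcoefZ qcoef_mono; case: eqP => [ei|_]; last by rewrite mulr0.
by case: eqP => [ej|_]; [case: ij; rewrite ei ej !ltn_ord | rewrite mulr0].
Qed.

Lemma qcoef_neq0 u : u != 0 -> exists i j, qcoef i j u != 0.
Proof.
move=> u0; apply: contrapT => ne; case/eqP: u0; apply: qcoef_inj => k l.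
rewrite qcoef0; apply: contrapT => /eqP kl; by apply: ne; exists k, l.
Qed.

Lemma qcoef_single u a b :
  (forall i j, qcoef i j u != 0 -> i = a /\ j = b) ->
  u = qcoef a b u *: qmono a b.
Proof.
move=> su; apply: qcoef_inj => k l; rewrite qcoefZ qcoef_mono.
case: andP => [[/eqP-> /eqP->]|kl]; first by rewrite mulr1.
rewrite mulr0; apply/eqP; apply: contraT => /su[ka lb].
by case: kl; rewrite ka lb !eqxx.
Qed.

Hypothesis q_neq0 : q != 0.

(** Without pure powers, every monomial present contains both letters and is a left multiple of
    [x * y]. *)
Lemma qcoef_axes0 u :
    (forall k, qcoef k 0 u = 0) -> (forall l, qcoef 0 l u = 0) ->
  exists v, u = v * (qx * qy).
Proof.
move=> u0x u0y; have [N /(_ N (leqnn N)) <-] := qtruncE u.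
pose P w := exists v, w = v * (qx * qy).
have P0 : P 0 by exists 0; rewrite mul0r.
have PD w w' : P w -> P w' -> P (w + w').
  by move=> [v ->] [v' ->]; exists (v + v'); rewrite mulrDl.
apply: (big_ind P) => // -[i iN] _; apply: (big_ind P) => // -[j jN] _ /=.
case: i iN => [|i] iN; first by rewrite u0y scale0r.
case: j jN => [|j] jN; first by rewrite u0x scale0r.
(* [q ^- j] compensates for moving [x] past [y ^+ j]. *)
exists ((qcoef i.+1 j.+1 u * q ^- j) *: qmono i j).
have yx : qy ^+ j * qx = q ^+ j *: (qx * qy ^+ j) by rewrite -[qx]expr1 qyx_exp mul1n.
rewrite -scalerAl /qmono -mulrA [qy ^+ j * _]mulrA yx -scalerAl -scalerAr scalerA.
by rewrite mulfVK ?expf_neq0 // exprSr [qy ^+ j.+1]exprSr !mulrA.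
Qed.

End QuantumPlaneBasis.

(** * Elementary rules for algebra automorphisms *)

Section AlgebraAutomorphisms.
Variables (K : comNzRingType) (A : algType K) (f : alg_aut A).

Lemma alg_aut0 : f 0 = 0.
Proof.
by have [fL _ _] := alg_autP f; have := fL (-1) 0 0; rewrite !scaleN1r oppr0 addr0 addNr.
Qed.

Lemma alg_autD : {morph f : u v / u + v}.
Proof. by have [fL _ _] := alg_autP f => u v; have := fL 1 u v; rewrite !scale1r. Qed.

Lemma alg_autZ : scalable f.
Proof.
by have [fL _ _] := alg_autP f => c u; have := fL c u 0; rewrite alg_aut0 !addr0.
Qed.

Lemma alg_autB : {morph f : u v / u - v}.
Proof. by move=> u v; rewrite alg_autD -scaleN1r alg_autZ scaleN1r. Qed.

Lemma alg_aut_sum (I : Type) (r : seq I) (P : pred I) (F : I -> A) :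
  f (\sum_(i <- r | P i) F i) = \sum_(i <- r | P i) f (F i).
Proof. exact: (big_morph _ alg_autD alg_aut0). Qed.

Lemma alg_aut1 : f 1 = 1.
Proof. by have [_ []] := alg_autP f. Qed.

Lemma alg_autM : {morph f : u v / u * v}.
Proof. by have [_ []] := alg_autP f. Qed.

Lemma alg_autX u n : f (u ^+ n) = f u ^+ n.
Proof. by elim: n => [|n IHn]; rewrite ?expr0 ?alg_aut1 // !exprS alg_autM IHn. Qed.

End AlgebraAutomorphisms.

(** * Inner derivations and their isotropy *)

Section InnerDerivation.
Variables (K : comNzRingType) (A : algType K) (w : A).

Definition inner_der_fun (u : A) : A := w * u - u * w.

Lemma inner_der_linear : linear inner_der_fun.
Proof.
move=> c u v; rewrite /inner_der_fun mulrDr mulrDl -scalerAl -scalerAr scalerBr.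
by rewrite opprD addrACA.
Qed.

Lemma inner_der_leibniz u v :
  inner_der_fun (u * v) = inner_der_fun u * v + u * inner_der_fun v.
Proof. by rewrite /inner_der_fun mulrBl mulrBr !mulrA addrA subrK. Qed.

Definition inner_der : derivation A := Derivation inner_der_linear inner_der_leibniz.

(** The failure to commute at [u] is the commutator of [rho w - w] with [rho u], and [rho] is
    surjective. *)
Lemma isotropy_inner_der (rho : alg_aut A) :
  rho \in isotropy inner_der <-> forall u, GRing.comm (rho w - w) u.
Proof.
have E u : rho (inner_der u) - inner_der (rho u) =
    (rho w - w) * rho u - rho u * (rho w - w).
  rewrite /= /inner_der_fun alg_autB !alg_autM mulrBl mulrBr.
  by rewrite !opprB !addrA addrAC [RHS]addrAC; congr (_ + _); exact: addrAC.
split=> [/asboolP comm u|comm].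
  rewrite -[u](alg_autKV rho); apply/subr0_eq; rewrite -E; apply/eqP.
  by rewrite subr_eq0; apply/eqP; exact: (congr1 (@^~ (alg_aut_inv rho u)) comm).
apply/asboolP/funext => u /=; apply/subr0_eq.
by rewrite E comm subrr.
Qed.

End InnerDerivation.

(** * Automorphisms, center and isotropy in the quantum plane *)

Section QuantumPlaneAutomorphisms.
Variables (K : fieldType) (q : K).
Hypotheses (q_neq0 : q != 0) (q_nroot : forall n : nat, (0 < n)%N -> q ^+ n != 1).
Local Notation A := (qplane q).
Implicit Types (rho sigma : alg_aut A) (u v w : A).
Local Notation x := (qx q).
Local Notation y := (qy q).
Local Notation m := (qmono q).

Lemma qmono_neq0 a b : m a b != 0.
Proof.
apply: contra_neq (oner_neq0 K) => m0.
by have := qcoef_mono q a b a b; rewrite m0 qcoef0 !eqxx.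
Qed.

(* [rho] preserves the commutator ideal, which is generated by the normal
   element [x * y]. *)
Lemma alg_aut_xy_dvd rho : exists v, rho (x * y) = v * (x * y).
Proof.
have YX : rho y * rho x = q *: (rho x * rho y).
  by rewrite -!alg_autM qyx alg_autZ.
(* On the axes both orders of multiplication give the same coefficient, so [YX] makes it a solution
   of [(1 - q) * c = 0]. *)
have axis k l : qcoef k l (rho x * rho y) = qcoef k l (rho y * rho x) ->
    qcoef k l (rho x * rho y) = 0.
  rewrite YX qcoefZ => /eqP; rewrite -subr_eq0 -{1}[qcoef _ _ _]mul1r -mulrBl mulf_eq0.
  by rewrite subr_eq0 eq_sym (negPf (q_nroot (n := 1) _)) // => /eqP.
rewrite alg_autM; apply: (qcoef_axes0 q_neq0) => [k|l]; apply: axis; rewrite !qcoefM.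
  exact: twconv_row0.
exact: twconv_col0.
Qed.

Lemma qplane_single_factor u v s t :
    u != 0 -> v != 0 -> (forall k l, qcoef k l (u * v) != 0 -> k = s /\ l = t) ->
  exists a b c d, [/\ (a + c = s)%N, (b + d = t)%N,
    u = qcoef a b u *: m a b & v = qcoef c d v *: m c d].
Proof.
move=> /qcoef_neq0 u0 /qcoef_neq0 v0 uv.
have [[N uN] [M vM]] := (qcoef_supp u, qcoef_supp v).
have [|a [b [c [d [ac bd su sv]]]]] := twconv_single q_neq0
  (supp_lt_le (leq_maxl N M) uN) (supp_lt_le (leq_maxr N M) vM) u0 v0 (s := s) (t := t).
  by move=> k l; rewrite -qcoefM; apply: uv.
by exists a, b, c, d; split=> //; apply: qcoef_single.
Qed.

(** Read off as coefficients, so defined before [rho] is known to be diagonal. *)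
Definition torus_of rho : K * K := (qcoef 1 0 (rho x), qcoef 0 1 (rho y)).

Lemma alg_aut_diag rho :
  rho x = (torus_of rho).1 *: x /\ rho y = (torus_of rho).2 *: y.
Proof.
have inj u v : rho u = rho v -> u = v by move/(can_inj (alg_autK rho)).
have xy0 : x * y != 0 by exact: (qmono_neq0 1 1).
have nz u : u != 0 -> rho u != 0.
  by move=> u0; apply: contra_neq u0 => e; apply: inj; rewrite e alg_aut0.
(* Divisibility for the inverse makes [rho (x * y)] a factor of [x * y], hence a monomial up to a
   scalar. *)
have [v vE] := alg_aut_xy_dvd (alg_aut_inv rho).
have xyE : x * y = rho v * rho (x * y) by rewrite -alg_autM -vE alg_autKV.
have rv0 : rho v != 0.
  by apply: contra_neq xy0 => e; rewrite xyE e mul0r.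
have [w wE] := alg_aut_xy_dvd rho.
have [|a [b [c [d [ac bd _ XYE]]]]] :=
    qplane_single_factor (s := 1) (t := 1) rv0 (nz _ xy0).
  move=> k l; rewrite -xyE -qmono11 qcoef_mono.
  by case: andP => [[/eqP-> /eqP->]|]; rewrite ?eqxx.
have n0 : qcoef c d (rho (x * y)) != 0.
  by apply: contra_neq (nz _ xy0) => e; rewrite XYE e scale0r.
(* At most 1 as exponents of a factor of [x * y], at least 1 because [x * y] divides
   [rho (x * y)]. *)
have [c1 d1] : c = 1%N /\ d = 1%N.
  move: n0; rewrite wE -qmono11 qcoefM.
  case/twconv_neq0 => i [j [i' [j' [_]]]]; rewrite qcoef_mono.
  by case: andP => [[/eqP-> /eqP->] _|_]; [lia | rewrite eqxx].
have x0 : x != 0 by rewrite -qmono10 qmono_neq0.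
have y0 : y != 0 by rewrite -qmono01 qmono_neq0.
have [|a' [b' [c' [d' [ac' bd' XE YE]]]]] :=
    qplane_single_factor (s := 1) (t := 1) (nz _ x0) (nz _ y0).
  move=> k l; rewrite -alg_autM XYE c1 d1 qcoefZ qcoef_mono.
  by case: andP => [[/eqP-> /eqP->]|]; rewrite ?mulr0 ?eqxx.
have notconst u (e : K) : (u == x) || (u == y) -> rho u <> e *: m 0 0.
  move=> uxy ue; have {ue} ue : u = e *: m 0 0.
    by apply: inj; rewrite ue qmono00 alg_autZ alg_aut1.
  move: uxy; rewrite ue => /orP[] /eqP /esym.
    by move/(congr1 (qcoef 1 0)); rewrite qcoefZ -qmono10 !qcoef_mono !mulr0 =>
      /eqP; rewrite oner_eq0.
  by move/(congr1 (qcoef 0 1)); rewrite qcoefZ -qmono01 !qcoef_mono !mulr0 =>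
      /eqP; rewrite oner_eq0.
(* Four ways to share [(1, 1)] between [rho x] and [rho y]: two make an image constant, one swaps
   the letters, one is diagonal. *)
case: a' b' ac' bd' XE => [|[|//]] [|[|//]] ac' bd' XE.
- by case: (notconst x _ _ XE); rewrite eqxx.
- have [c'1 d'0] : c' = 1%N /\ d' = 0%N by lia.
  have [be {}XE] : exists e, rho x = e *: y.
    by rewrite -qmono01; exists (qcoef 0 1 (rho x)).
  have [al {}YE] : exists e, rho y = e *: x.
    by rewrite -qmono10; exists (qcoef c' d' (rho y)); rewrite {1}YE c'1 d'0.
  have ab0 : al * be != 0.
    rewrite mulf_neq0 //.
      by apply: contra_neq (nz _ y0) => e; rewrite YE e scale0r.
    by apply: contra_neq (nz _ x0) => e; rewrite XE e scale0r.
  (* A swap would turn the defining relation into [q ^+ 2 = 1]. *)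
  have := congr1 (qcoef 1 1 \o rho) (qyx q).
  rewrite /= alg_autZ !alg_autM XE YE -!(scalerAl, scalerAr) !scalerA qyx scalerA.
  rewrite !qcoefZ -qmono11 qcoef_mono !eqxx !mulr1.
  have -> : q * be * al * q = q ^+ 2 * (al * be).
    by rewrite expr2 -!mulrA; congr (_ * _); rewrite mulrCA mulrA mulrC.
  move/eqP; rewrite -subr_eq0 -{1}[al * be]mul1r -mulrBl mulf_eq0 (negPf ab0) orbF.
  by rewrite subr_eq0 eq_sym (negPf (q_nroot (n := 2) _)).
- have [c'0 d'1] : c' = 0%N /\ d' = 1%N by lia.
  by rewrite {1}XE {1}YE c'0 d'1 qmono10 qmono01.
have [c'0 d'0] : c' = 0%N /\ d' = 0%N by lia.
by move: YE; rewrite c'0 d'0 => /notconst; case; rewrite eqxx orbT.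
Qed.

Lemma alg_aut_mono rho a b :
  rho (m a b) = torus_char a b (torus_of rho) *: m a b.
Proof.
have [rx ry] := alg_aut_diag rho.
by rewrite /qmono alg_autM !alg_autX rx ry !exprZn -scalerAl -scalerAr scalerA.
Qed.

Lemma torus_of_neq0 rho : (torus_of rho).1 != 0 /\ (torus_of rho).2 != 0.
Proof.
have [rx ry] := alg_aut_diag rho.
have inj := can_inj (alg_autK rho).
by split; [apply: contra_neq (qmono_neq0 1 0) => e
         | apply: contra_neq (qmono_neq0 0 1) => e];
  apply: inj; rewrite alg_aut0 ?qmono10 ?qmono01 ?rx ?ry e scale0r.
Qed.

Lemma torus_ofM rho sigma : torus_of (rho * sigma)%g = torus_of rho * torus_of sigma.
Proof.
have [[rx ry] [sx sy]] := (alg_aut_diag rho, alg_aut_diag sigma).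
have E u : (rho * sigma)%g u = rho (sigma u) by [].
rewrite {1}/torus_of !E sx sy !alg_autZ rx ry !qcoefZ -qmono10 -qmono01 !qcoef_mono.
by rewrite !eqxx !mulr1 mulrC [X in (_, X)]mulrC.
Qed.

Lemma torus_of1 : torus_of 1%g = 1.
Proof. by rewrite /torus_of /= -qmono10 -qmono01 !qcoef_mono. Qed.

Lemma torus_of_inj : injective torus_of.
Proof.
move=> rho sigma e; apply/alg_aut_eqP; elim/qplane_ind => [|u v eu ev|c u eu|a b].
- by rewrite !alg_aut0.
- by rewrite !alg_autD eu ev.
- by rewrite !alg_autZ eu.
by rewrite !alg_aut_mono e.
Qed.

(** Commuting with [m c d] forces [q ^+ (b * c) = q ^+ (d * a)] where the coefficient is nonzero;
    [y] then tests [a] and [x] tests [b]. *)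
Lemma qplane_central_coef u : (forall v, GRing.comm u v) ->
  forall a b, (a, b) != (0%N, 0%N) -> qcoef a b u = 0.
Proof.
move=> cu a b ab0.
have supp i j k l : qcoef i j (m k l) != 0 -> i = k /\ j = l.
  by rewrite qcoef_mono; case: andP => [[/eqP-> /eqP->]|]; rewrite ?eqxx.
have cM c d : q ^+ (b * c) * qcoef a b u = q ^+ (d * a) * qcoef a b u.
  have := congr1 (qcoef (a + c) (b + d)) (cu (m c d)); rewrite !qcoefM.
  rewrite twconv_extreme => [|i j i' j' _ /supp[-> ->]]; last by move=> /addIn-> /addIn->.
  rewrite [(a + c)%N]addnC [(b + d)%N]addnC twconv_extreme; last first.
    by move=> i j i' j' /supp[-> ->].
  by rewrite !qcoef_mono !eqxx mulr1 mul1r.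
have root n : (0 < n)%N -> q ^+ n * qcoef a b u = qcoef a b u -> qcoef a b u = 0.
  move=> n0 /eqP; rewrite -subr_eq0 -{2}[qcoef a b u]mul1r -mulrBl mulf_eq0 subr_eq0.
  by rewrite (negPf (q_nroot n0)) => /eqP.
case: b ab0 root cM => [|b] ab0 root cM.
  apply: (root a); first by case: (a) ab0.
  by have := cM 0%N 1%N; rewrite mul0n mul1n mul1r.
by apply: (root b.+1) => //; have := cM 1%N 0%N; rewrite mul0n muln1 mul1r.
Qed.

Lemma finite_subgroup_isotropy (G : {pred alg_aut A}) :
    group_closed G -> finite_set [set` G]%classic ->
  exists w, isotropy (inner_der w) = G.
Proof.
move=> [G1 GV] /finite_seqP[sG sGE].
have memG rho : (rho \in sG) = (rho \in G).
  apply/idP/idP => h.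
    by have : [set` G]%classic rho; rewrite // sGE.
  by have : [set` sG]%classic rho; rewrite // -sGE.
have GM : {in G &, forall rho sigma, (rho * sigma)%g \in G} by exact: group_closedM.
(* The image of [G] in the torus; it determines [G] because [torus_of] is injective. *)
pose s := undup (map torus_of sG).
have memS rho : (torus_of rho \in s) = (rho \in G).
  by rewrite mem_undup mem_map ?memG //; exact: torus_of_inj.
have sP g : g \in s -> exists2 rho, rho \in G & g = torus_of rho.
  by rewrite mem_undup => /mapP[rho]; rewrite memG => rhoG ->; exists rho.
have s1 : 1 \in s by rewrite -torus_of1 memS.
have sM : {in s &, forall g h, g * h \in s}.
  move=> _ _ /sP[rho rG ->] /sP[sigma sG' ->]; rewrite -torus_ofM memS; exact: GM.
have s0 : {in s, forall g, g.1 != 0 /\ g.2 != 0}.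
  by move=> _ /sP[rho _ ->]; exact: torus_of_neq0.
pose n := size s.
(* The range up to [n] inclusive, without the constant monomial, matches [torus_biorth_bounded]. *)
pose P (ab : 'I_n.+1 * 'I_n.+1) := (ab != (ord0, ord0)) &&
  all (fun g => torus_char ab.1 ab.2 g == 1) s.
pose w : A := \sum_(ab | P ab) m ab.1 ab.2.
have w_fix rho : rho \in G -> rho w = w.
  move=> rG; rewrite alg_aut_sum; apply: eq_bigr => ab /andP[_ /allP abP].
  by rewrite alg_aut_mono (eqP (abP _ _)) ?scale1r // memS.
exists w; apply: funext => rho.
rewrite -[LHS]/(rho \in isotropy (inner_der w)) -[RHS]/(rho \in G).
apply/idP/idP => [/isotropy_inner_der central|rG]; last first.
  by apply/isotropy_inner_der => u; rewrite w_fix // subrr /GRing.comm mul0r mulr0.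
rewrite -memS; have [h1 h2] := torus_of_neq0 rho.
apply: (torus_biorth_bounded (undup_uniq _) s1 sM s0) => // a b an bn ab0 abP.
(* The coefficient of this invariant monomial in [rho w - w] is its character value at [rho] minus
   1, and centrality makes it vanish. *)
have := qplane_central_coef central ab0.
rewrite -ltnS in an; rewrite -ltnS in bn.
pose p := (Ordinal an, Ordinal bn) : 'I_n.+1 * 'I_n.+1.
have Pp : P p.
  rewrite /P; apply/andP; split; first by move: ab0; rewrite /p !xpair_eqE.
  by apply/allP => g /abP ->.
rewrite qcoefB alg_aut_sum !qcoef_sum (bigD1 p) //= [X in _ - X](bigD1 p) //=.
have z (F : 'I_n.+1 * 'I_n.+1 -> K) :
    \sum_(i | P i && (i != p)) F i * qcoef a b (m i.1 i.2) = 0.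
  apply: big1 => -[i j] /andP[_]; rewrite xpair_eqE -!val_eqE /= qcoef_mono.
  by rewrite [a == _]eq_sym [b == _]eq_sym => /negPf->; rewrite mulr0.
have zE : \sum_(i | P i && (i != p)) qcoef a b (m i.1 i.2) = 0.
  by rewrite -[RHS](z (fun=> 1)); apply: eq_bigr => i _; rewrite mul1r.
rewrite zE; under eq_bigr => i _ do rewrite alg_aut_mono qcoefZ.
rewrite z alg_aut_mono qcoefZ qcoef_mono !eqxx mulr1 !addr0 => /eqP.
by rewrite subr_eq0 => /eqP.
Qed.

End QuantumPlaneAutomorphisms.

(** * Realization of finite subgroups as isotropy groups *)

Local Open Scope classical_set_scope.

Theorem theorem7 (K : fieldType) (infK : infinite_set [set: K])
    (q : K) (q_neq0 : q != 0) (q_nroot : forall n : nat, (0 < n)%N -> q ^+ n != 1)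
    (G : {pred alg_aut (qplane q)})
    (subG : group_closed G) (finG : finite_set [set` G]) :
  exists d : derivation (qplane q), group_isog (isotropy d) G.
Proof.
have [w wG] := finite_subgroup_isotropy q_neq0 q_nroot subG finG.
(* The isotropy group equals [G], so the identity map is the isomorphism. *)
exists (inner_der w); rewrite wG; exists id; split=> //.
by split=> // rho rhoG; exists rho.
Qed.
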